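(* Let $\mathcal{V}=\{\bar P_\theta\colon\theta\in\Theta\subset\mathbb{R}^d\}\subset\mathcal{W}(\mathcal{X},\mathcal{D})$ be a smoothly parametrized family of irreducible stochastic matrices ($\Theta$ open), and let $\Lambda_\star\colon\mathcal{W}(\mathcal{X},\mathcal{D})\to\mathcal{W}(\mathcal{Y},\mathcal{E})$ be a Markov embedding. For $\theta,\theta'\in\Theta$, put $P_\theta=\Lambda_\star\bar P_\theta$ and $P_{\theta'}=\Lambda_\star\bar P_{\theta'}$. Then for any $i,j,k\in\{1,\dots,d\}$, $$\mathfrak{g}_{ij}(P_\theta)=\mathfrak{g}_{ij}(\bar P_\theta),\qquad D(P_\theta\|P_{\theta'})=D(\bar P_\theta\|\bar P_{\theta'}),$$ $$\Gamma^{(e)}_{ij,k}(P_\theta)=\Gamma^{(e)}_{ij,k}(\bar P_\theta),\qquad \Gamma^{(m)}_{ij,k}(P_\theta)=\Gamma^{(m)}_{ij,k}(\bar P_\theta).$$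
   Context: All vertex sets are finite with at least two elements; $(\mathcal{X},\mathcal{D})$, $(\mathcal{Y},\mathcal{E})$ are strongly connected digraphs. $\mathcal{F}_+(\mathcal{Y},\mathcal{E})$ is the set of functions $\mathcal{Y}^2\to\mathbb{R}$ that are strictly positive on $\mathcal{E}$ and zero outside $\mathcal{E}$; $\mathcal{W}(\mathcal{Y},\mathcal{E})$ is the set of $P\in\mathcal{F}_+(\mathcal{Y},\mathcal{E})$ whose rows sum to $1$. Each $P\in\mathcal{W}(\mathcal{Y},\mathcal{E})$ has a unique stationary distribution $\pi$ and edge measure $Q(y,y')=\pi(y)P(y,y')$. Markov embedding: a map $\Lambda_\star\colon\mathcal{W}(\mathcal{X},\mathcal{D})\to\mathcal{W}(\mathcal{Y},\mathcal{E})$, $\Lambda_\star P(y,y')=P(\kappa(y),\kappa(y'))\Lambda(y,y')$ for $(y,y')\in\mathcal{E}$ (and $0$ otherwise), where (i) $\kappa\colon\mathcal{Y}\to\mathcal{X}$ is surjective, $\{(\kappa(y),\kappa(y')):(y,y')\in\mathcal{E}\}=\mathcal{D}$, and for every $(x,x')\in\mathcal{D}$ and $y\in\kappa^{-1}(x)$ there is $y'\in\kappa^{-1}(x')$ with $(y,y')\in\mathcal{E}$; (ii) $\Lambda\in\mathcal{F}_+(\mathcal{Y},\mathcal{E})$; (iii) for all $y\in\mathcal{Y}$, $x'\in\mathcal{X}$ with $(\kappa(y),x')\in\mathcal{D}$, $(\Lambda(y,y'))_{y'\in\kappa^{-1}(x')}$ is a probability distribution on $\kappa^{-1}(x')$.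 For a smoothly parametrized family $P_\theta\in\mathcal{W}(\mathcal{Y},\mathcal{E})$ with edge measures $Q_\theta$, writing $\partial_i=\partial/\partial\theta_i$ (and likewise on $(\mathcal{X},\mathcal{D})$ with sums over $\mathcal{D}$): $\mathfrak{g}_{ij}(P_\theta)=\sum_{(y,y')\in\mathcal{E}}Q_\theta(y,y')\,\partial_i\log P_\theta(y,y')\,\partial_j\log P_\theta(y,y')$; $\Gamma^{(e)}_{ij,k}(P_\theta)=\sum_{(y,y')\in\mathcal{E}}\partial_i\partial_j\log P_\theta(y,y')\,\partial_kQ_\theta(y,y')$; $\Gamma^{(m)}_{ij,k}(P_\theta)=\sum_{(y,y')\in\mathcal{E}}\partial_i\partial_jQ_\theta(y,y')\,\partial_k\log P_\theta(y,y')$. The divergence is $D(P\|P')=\sum_{(y,y')\in\mathcal{E}}\pi(y)P(y,y')\log\frac{P(y,y')}{P'(y,y')}$, with $\pi$ the stationary distribution of $P$. *)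

(* Defs.v *)
From HB Require Import structures.
From mathcomp Require Import all_boot all_order all_algebra.
From mathcomp Require Import all_classical all_reals all_analysis.

Set Implicit Arguments.
Unset Strict Implicit.
Unset Printing Implicit Defensive.

Import Order.TTheory GRing.Theory Num.Theory.
Import numFieldNormedType.Exports.

Local Open Scope classical_set_scope.
Local Open Scope ring_scope.

Section Digraphs.
Context {R : realType} {X : finType}.
Implicit Types (D : {set X * X}) (P : X * X -> R) (mu : X -> R).

Definition strongly_connected D : Prop :=
  forall x x' : X, connect (fun a b => (a, b) \in D) x x'.

Definition Fpos D : set (X * X -> R) :=
  [set f | (forall e, e \in D -> 0 < f e) /\ (forall e, e \notin D -> f e = 0)].

Definition Wstoch D : set (X * X -> R) :=
  [set P | Fpos D P /\ forall x, \sum_(x' : X) P (x, x') = 1].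

Definition is_stationary P mu : Prop :=
  [/\ forall x, 0 <= mu x,
      \sum_(x : X) mu x = 1 &
      forall x', \sum_(x : X) mu x * P (x, x') = mu x'].

(* The default value 0 is never used for P in Wstoch D with D strongly
   connected: a stationary distribution then exists and is unique. *)
Definition stationary P : X -> R :=
  xget (fun=> 0) [set mu | is_stationary P mu].

Definition edge_measure P : X * X -> R := fun e => stationary P e.1 * P e.

Definition divergence D P P' : R :=
  \sum_(e in D) stationary P e.1 * P e * ln (P e / P' e).

End Digraphs.

Section MarkovEmbedding.
Context {R : realType} {X Y : finType}.
Variables (D : {set X * X}) (E : {set Y * Y}).

Definition compatible_surjection (kappa : Y -> X) : Prop :=
  [/\ forall x, exists y, kappa y = x,
      [set (kappa e.1, kappa e.2) | e in E]%SET = D &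
      forall x x' y, (x, x') \in D -> kappa y = x ->
        exists2 y', kappa y' = x' & (y, y') \in E].

Definition fibrewise_probability (kappa : Y -> X) (Lambda : Y * Y -> R) :
    Prop :=
  forall y x', (kappa y, x') \in D ->
    (forall y', kappa y' = x' -> 0 <= Lambda (y, y')) /\
    \sum_(y' | kappa y' == x') Lambda (y, y') = 1.

(* [Lstar] is a map between types of arbitrary functions; only its
   restriction to [Wstoch D] is constrained. *)
Definition Markov_embedding (Lstar : (X * X -> R) -> (Y * Y -> R)) : Prop :=
  {homo Lstar : P / Wstoch D P >-> Wstoch E P} /\
  exists (kappa : Y -> X) (Lambda : Y * Y -> R),
    [/\ compatible_surjection kappa,
        Fpos E Lambda,
        fibrewise_probability kappa Lambda &
        forall P, Wstoch D P -> forall y y',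
          Lstar P (y, y') =
            if (y, y') \in E then P (kappa y, kappa y') * Lambda (y, y')
            else 0].

End MarkovEmbedding.

Section Calculus.
Context {R : realType} {d : nat}.
Implicit Types (f : 'rV[R]_d -> R) (Theta : set 'rV[R]_d).

Definition partial (i : 'I_d) f : 'rV[R]_d -> R :=
  fun theta => 'D_(delta_mx 0 i) f theta.

(* Partial derivatives of every order, taken in every order of the indices,
   exist and are continuous at every point of the open set Theta. *)
Definition smooth_on Theta f : Prop :=
  forall (s : seq 'I_d) (theta : 'rV[R]_d), Theta theta ->
    {for theta, continuous (foldr partial f s)} /\
    forall i : 'I_d, derivable (foldr partial f s) theta (delta_mx 0 i).

End Calculus.

Section InformationGeometry.
Context {R : realType} {X : finType} {d : nat}.
Variables (D : {set X * X}) (P : 'rV[R]_d -> X * X -> R).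

Definition log_entry (e : X * X) : 'rV[R]_d -> R := fun theta => ln (P theta e).

Definition edge_entry (e : X * X) : 'rV[R]_d -> R :=
  fun theta => edge_measure (P theta) e.

Definition fisher_metric (i j : 'I_d) (theta : 'rV[R]_d) : R :=
  \sum_(e in D) edge_entry e theta *
    partial i (log_entry e) theta * partial j (log_entry e) theta.

Definition e_connection (i j k : 'I_d) (theta : 'rV[R]_d) : R :=
  \sum_(e in D) partial i (partial j (log_entry e)) theta *
    partial k (edge_entry e) theta.

Definition m_connection (i j k : 'I_d) (theta : 'rV[R]_d) : R :=
  \sum_(e in D) partial i (partial j (edge_entry e)) theta *
    partial k (log_entry e) theta.

End InformationGeometry.

Definition smooth_family {R : realType} {X : finType} {d : nat}
    (D : {set X * X}) (Theta : set 'rV[R]_d) (P : 'rV[R]_d -> X * X -> R) :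
    Prop :=
  [/\ open Theta,
      forall theta, Theta theta -> Wstoch D (P theta) &
      forall e, smooth_on Theta (fun theta => P theta e)].

(* Main.v *)
Require Import Defs.
From HB Require Import structures.
From mathcomp Require Import all_boot all_order all_algebra.
From mathcomp Require Import all_classical all_reals all_analysis.

(* Write kappa also for the induced map E -> D. On E, log P = log barP o kappa +
   log Lambda with the last term independent of the parameter, so the partial
   derivatives of log P are pulled back along kappa and every sum over E reduces
   to the sums of Q, or of its partial derivatives, over the fibres of kappa.
   The image under kappa of the stationary law of P is stationary for barP, so
   by uniqueness it is the stationary law of barP and Q sums to barQ over each
   fibre; the fibre sums commute with partial derivatives once Q is known to be
   differentiable. For this, I - P + J (J the all-ones matrix) is invertible by
   the maximum principle, and the stationary law is the row vector
   (1, ..., 1) (I - P + J)^-1, a rational function of the entries of P. *)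

Set Implicit Arguments.
Unset Strict Implicit.
Unset Printing Implicit Defensive.

Import Order.TTheory GRing.Theory Num.Theory.
Import numFieldNormedType.Exports.

Local Open Scope classical_set_scope.
Local Open Scope ring_scope.

(** * Stationary law of an irreducible stochastic matrix *)

Section StationaryDistribution.
Context {R : realType} {X : finType}.
Variables (D : {set X * X}) (P : X * X -> R).
Hypotheses (cardX : (0 < #|X|)%N) (connD : strongly_connected D).
Hypothesis (WP : Wstoch D P).

Lemma Wstoch_ge0 (e : X * X) : 0 <= P e.
Proof.
case: WP => -[P_gt0 P_eq0] _; have [/P_gt0/ltW //|/P_eq0 -> //] := boolP (e \in D).
Qed.

(* Evaluate at a maximum of [u]. *)
Lemma stochastic_shift_le0 (u : X -> R) (s : R) :
  (forall x, \sum_x' P (x, x') * u x' = u x + s) -> s <= 0.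
Proof.
move=> Pu; have /card_gt0P[x0 _] := cardX.
case: (Order.TotalTheory.arg_maxP u (isT : xpredT x0)) => xm _ umax.
rewrite -(lerD2l (u xm)) addr0 -Pu.
have -> : u xm = \sum_x' P (xm, x') * u xm by rewrite -mulr_suml WP.2 mul1r.
by apply: ler_sum => x _; apply: ler_wpM2l; [exact: Wstoch_ge0 | exact: umax].
Qed.

(** Maximum principle: at a maximum point of [u] the [P]-average equals the maximum only if every
    successor is a maximum point too. Strong connectivity carries this along paths to all
    vertices. *)
Lemma stochastic_harmonic_const (u : X -> R) :
  (forall x, \sum_x' P (x, x') * u x' = u x) -> forall x y, u x = u y.
Proof.
move=> Pu; have /card_gt0P[x0 _] := cardX.
case: (Order.TotalTheory.arg_maxP u (isT : xpredT x0)) => xm _ umax.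
have {}umax y : u y <= u xm by exact: umax.
suff um x : u x = u xm by move=> x y; rewrite !um.
have /connectP[p pathp ->] := connD xm x.
elim: p (xm) pathp umax => [|b p IHp] a //= /andP[abD pathp] umax.
have uba : u b = u a.
  have sum0 : \sum_x' P (a, x') * (u a - u x') = 0.
    under eq_bigr do rewrite mulrBr.
    by rewrite sumrB -mulr_suml WP.2 mul1r Pu subrr.
  have /eqP : P (a, b) * (u a - u b) = 0.
    apply: (psumr_eq0P _ sum0) => // x' _.
    by rewrite mulr_ge0 ?Wstoch_ge0 // subr_ge0 umax.
  by rewrite mulf_eq0 gt_eqF ?WP.1.1 //= subr_eq0 => /eqP ->.
by rewrite -uba; apply: IHp => // y; rewrite uba umax.
Qed.

(** Adding 1 to each entry of the singular matrix I - P records the total mass, so one invertible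
    system encodes both invariance and normalisation. *)
Definition stationary_mx : 'M[R]_#|X| :=
  \matrix_(i, j) ((i == j)%:R - P (enum_val i, enum_val j) + 1).

Lemma sum_enum_val (F : X -> R) : \sum_(i < #|X|) F (enum_val i) = \sum_x F x.
Proof. by rewrite [RHS](reindex _ (onW_bij _ (@enum_val_bij X))). Qed.

(** A right kernel vector [u] with sum [s] satisfies P u = u + s. The shift bound for [u] and for
    its opposite forces [s = 0], so [u] is harmonic, hence constant, hence zero. *)
Lemma stationary_mx_unit : stationary_mx \in unitmx.
Proof.
rewrite -unitmx_tr -row_free_unit; apply: inj_row_free => v vM.
pose u x := v 0 (enum_rank x); pose s := \sum_x u x.
have Pu x : \sum_x' P (x, x') * u x' = u x + s.
  have /rowP/(_ (enum_rank x)) := vM; rewrite !mxE => vMx.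
  apply/eqP; rewrite eq_sym -subr_eq0 -[X in _ == X]vMx; apply/eqP.
  rewrite (eq_bigr (fun i => (fun x' =>
    u x' * ((x == x')%:R - P (x, x') + 1)) (enum_val i))); last first.
    move=> i _; rewrite !mxE /u !enum_valK enum_rankK.
    by rewrite -(inj_eq enum_val_inj) enum_rankK.
  rewrite (sum_enum_val (fun x' => u x' * ((x == x')%:R - P (x, x') + 1))).
  under [RHS]eq_bigr do rewrite mulrDr mulr1 mulrBr [u _ * P _]mulrC.
  rewrite big_split sumrB /= [X in _ = X - _ + _](bigD1 x) //= eqxx mulr1.
  rewrite [X in _ = _ + X - _ + _]big1 ?addr0.
    by rewrite -/s addrAC.
  by move=> x' /negPf nx; rewrite eq_sym nx mulr0.
have s0 : s = 0.
  apply/eqP; rewrite eq_le (stochastic_shift_le0 Pu) /=.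
  rewrite -oppr_le0; apply: (@stochastic_shift_le0 (fun x => - u x)) => x.
  by under eq_bigr do rewrite mulrN; rewrite sumrN Pu opprD.
have ux x : u x = 0.
  have uc : forall x y, u x = u y.
    by apply: stochastic_harmonic_const => y; rewrite Pu s0 addr0.
  have : s = u x *+ #|X|.
    by rewrite /s (eq_bigr (fun=> u x)) ?sumr_const // => y _; rewrite (uc y x).
  by rewrite s0 => /esym/eqP; rewrite mulrn_eq0 eqn0Ngt cardX => /eqP.
by apply/rowP => i; rewrite mxE -(enum_valK i) -/(u (enum_val i)) ux.
Qed.

(** Signed measures are allowed, so that uniqueness is available before positivity is known. *)
Definition invariant (mu : X -> R) : Prop :=
  forall x', \sum_x mu x * P (x, x') = mu x'.

Lemma mul_stationary_mx (mu : X -> R) (i : 'I_#|X|) :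
  ((\row_i mu (enum_val i)) *m stationary_mx) 0 i =
  mu (enum_val i) - \sum_x mu x * P (x, enum_val i) + \sum_x mu x.
Proof.
rewrite mxE (eq_bigr (fun j => (fun x => mu x *
    ((x == enum_val i)%:R - P (x, enum_val i) + 1)) (enum_val j))); last first.
  by move=> j _; rewrite !mxE (inj_eq enum_val_inj).
rewrite (sum_enum_val (fun x =>
  mu x * ((x == enum_val i)%:R - P (x, enum_val i) + 1))).
under eq_bigr do rewrite mulrDr mulr1 mulrBr.
rewrite big_split sumrB /= (bigD1 (enum_val i)) //= eqxx mulr1 big1 ?addr0 //.
by move=> x /negPf ->; rewrite mulr0.
Qed.

(** The invertible matrix sends an invariant [mu] to the constant row whose entries are its mass. *)
Lemma invariant_uniq (mu nu : X -> R) : invariant mu -> invariant nu ->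
  \sum_x mu x = \sum_x nu x -> mu =1 nu.
Proof.
move=> imu inu sums x.
suff /rowP/(_ (enum_rank x)) :
  (\row_i mu (enum_val i)) = (\row_i nu (enum_val i)) :> 'rV[R]_#|X|.
  by rewrite !mxE enum_rankK.
apply: (can_inj (mulmxK stationary_mx_unit)).
apply/rowP => i; rewrite !mul_stationary_mx imu inu.
by rewrite !subrr sums.
Qed.

Definition stationary_sol (x : X) : R :=
  ((const_mx 1 : 'rV_#|X|) *m invmx stationary_mx) 0 (enum_rank x).

(** Summed over all states, the defining equation loses its I - P terms because rows of [P] sum to
    1; this fixes the mass at 1, and the equation then reduces to invariance. *)
Lemma stationary_sol_mass_invariant :
  \sum_x stationary_sol x = 1 /\ invariant stationary_sol.
Proof.
have sol x' : stationary_sol x' - \sum_x stationary_sol x * P (x, x') +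
    \sum_x stationary_sol x = 1.
  have := mul_stationary_mx stationary_sol (enum_rank x').
  rewrite enum_rankK => <-.
  rewrite (_ : \row_i _ = const_mx 1 *m invmx stationary_mx).
    by rewrite mulmxKV ?stationary_mx_unit // mxE.
  by apply/rowP => i; rewrite mxE /stationary_sol enum_valK.
have sum1 : \sum_x stationary_sol x = 1.
  have : \sum_(x' : X) (stationary_sol x' -
      \sum_x stationary_sol x * P (x, x') + \sum_x stationary_sol x) =
      \sum_(x' : X) 1 by apply: eq_bigr => x' _; exact: sol.
  rewrite big_split sumrB exchange_big /=.
  under [X in _ - X]eq_bigr do rewrite -mulr_sumr WP.2 mulr1.
  rewrite subrr add0r !sumr_const => /eqP.
  by rewrite -subr_eq0 -mulrnBl mulrn_eq0 eqn0Ngt cardX subr_eq0 => /eqP.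
split=> // x'; have := sol x'.
by rewrite sum1 => /eqP; rewrite -subr_eq0 addrK subr_eq0 => /eqP.
Qed.

(* The total variation of an invariant signed measure is invariant, because
   [|mu| <= |mu| P] and both sides have the same mass; by uniqueness a mass-one
   solution is proportional to its absolute value. *)
Lemma stationary_sol_ge0 (x : X) : 0 <= stationary_sol x.
Proof.
have [sum1 inv] := stationary_sol_mass_invariant.
set mu := stationary_sol in sum1 inv *.
have le_abs y : `|mu y| <= \sum_x `|mu x| * P (x, y).
  rewrite -{1}inv; apply: le_trans (ler_norm_sum _ _ _) _.
  by apply: ler_sum => z _; rewrite normrM (ger0_norm (Wstoch_ge0 _)).
have inv_abs : invariant (fun x => `|mu x|).
  move=> y; apply/eqP; rewrite -subr_eq0; apply/eqP.
  have ge0 z : true -> 0 <= \sum_x `|mu x| * P (x, z) - `|mu z|.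
    by rewrite subr_ge0.
  apply: (psumr_eq0P ge0) => //.
  rewrite sumrB exchange_big /=.
  under eq_bigr do rewrite -mulr_sumr WP.2 mulr1.
  by rewrite subrr.
pose a := \sum_x `|mu x|.
have a1 : 1 <= a by rewrite -sum1; apply: ler_sum => z _; exact: ler_norm.
have a0 : 0 < a by apply: lt_le_trans a1.
rewrite (@invariant_uniq mu (fun x => a^-1 * `|mu x|)) //.
- by rewrite mulr_ge0 // invr_ge0 ltW.
- by move=> y; under eq_bigr do rewrite -mulrA; rewrite -mulr_sumr inv_abs.
- by rewrite -mulr_sumr mulVf ?gt_eqF.
Qed.

(** [stationary_sol] inhabits the set chosen from, so [xget] does not fall back on its default. *)
Lemma stationaryP : is_stationary P (stationary P).
Proof.
have [sum1 inv] := stationary_sol_mass_invariant.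
apply: (@xgetPex _ _ [set mu | is_stationary P mu]).
by exists stationary_sol; split=> //; exact: stationary_sol_ge0.
Qed.

Lemma stationary_uniq (mu : X -> R) : is_stationary P mu -> stationary P =1 mu.
Proof.
by case=> _ m1 im; case: stationaryP => _ s1 is_; apply: invariant_uniq; rewrite ?s1.
Qed.

Lemma stationary_solE : stationary P =1 stationary_sol.
Proof.
have [sum1 inv] := stationary_sol_mass_invariant.
by apply: stationary_uniq; split=> //; exact: stationary_sol_ge0.
Qed.

(** Cramer's rule makes each weight an explicit rational function of the entries of [P]. *)
Lemma stationary_cramer (x : X) : stationary P x =
  (\det stationary_mx)^-1 * \sum_i (\adj stationary_mx) i (enum_rank x).
Proof.
rewrite stationary_solE /stationary_sol /invmx stationary_mx_unit -scalemxAr.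
by rewrite !mxE; congr (_ * _); apply: eq_bigr => i _; rewrite mxE mul1r.
Qed.

End StationaryDistribution.

(** * Existence of iterated partial derivatives on an open set *)

Section IteratedPartials.
Context {R : realType} {d : nat}.
Variable Theta : set 'rV[R]_d.
Hypothesis oTheta : open Theta.
Implicit Types f g : 'rV[R]_d -> R.

Lemma near_open (Q : set 'rV[R]_d) t :
  Theta t -> (forall t, Theta t -> Q t) -> \forall u \near t, Q u.
Proof.
move=> Tt TQ; have : nbhs t Theta by apply: open_nbhs_nbhs.
by apply: filterS => u; exact: TQ.
Qed.

Lemma eq_partial f g (i : 'I_d) :
  (forall t, Theta t -> f t = g t) ->
  forall t, Theta t -> partial i f t = partial i g t.
Proof. by move=> fg t Tt; apply: near_eq_derive; exact: near_open. Qed.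

(** Counting the order lets the closure rules go by induction on [n]: a partial derivative of a
    product or an inverse is again built from functions of order [n]. *)
Fixpoint pdiff (n : nat) f : Prop :=
  if n is m.+1 then
    (forall t, Theta t -> forall i : 'I_d, derivable f t (delta_mx 0 i)) /\
    (forall i : 'I_d, pdiff m (partial i f))
  else True.

Lemma eq_pdiff n f g :
  (forall t, Theta t -> f t = g t) -> pdiff n f -> pdiff n g.
Proof.
elim: n f g => [|n IHn] f g fg //= [df pf]; split=> [t Tt i | i].
  exact: near_eq_derivable (near_open Tt fg) (df t Tt i).
by apply: IHn (pf i); exact: eq_partial.
Qed.

Lemma pdiffW n f : pdiff n.+1 f -> pdiff n f.
Proof.
by elim: n f => // n IHn f [df pf]; split=> // i; exact/IHn/pf.
Qed.

Lemma smooth_on_pdiff n f : smooth_on Theta f -> pdiff n f.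
Proof.
(* The induction must range over all lists of derivatives already taken; the empty list gives
   [f]. *)
move=> sf; rewrite -[f]/(foldr partial f [::]).
elim: n [::] => //= n IHn s; split=> [t Tt i | i]; first exact: (sf s t Tt).2.
exact: (IHn (i :: s)).
Qed.

Lemma pdiff_cst n (c : R) : pdiff n (fun=> c).
Proof.
elim: n c => //= n IHn c; split=> [t _ i | i]; first exact: derivable_cst.
by apply: eq_pdiff (IHn 0) => t _; rewrite /partial derive_cst.
Qed.

Lemma partialD f g (i : 'I_d) t :
  derivable f t (delta_mx 0 i) -> derivable g t (delta_mx 0 i) ->
  partial i (fun u => f u + g u) t = partial i f t + partial i g t.
Proof. exact: deriveD. Qed.

Lemma pdiffD n f g : pdiff n f -> pdiff n g -> pdiff n (fun t => f t + g t).
Proof.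
elim: n f g => //= n IHn f g [df pf] [dg pg]; split=> [t Tt i | i].
  exact: (derivableD (df t Tt i) (dg t Tt i)).
apply: eq_pdiff (IHn _ _ (pf i) (pg i)) => t Tt.
by rewrite partialD; [ | exact: df | exact: dg].
Qed.

Lemma pdiffM n f g : pdiff n f -> pdiff n g -> pdiff n (fun t => f t * g t).
Proof.
elim: n f g => //= n IHn f g [df pf] [dg pg]; split=> [t Tt i | i].
  exact: (derivableM (df t Tt i) (dg t Tt i)).
have fn : pdiff n f by apply: pdiffW; split.
have gn : pdiff n g by apply: pdiffW; split.
apply: eq_pdiff (pdiffD (IHn _ _ fn (pg i)) (IHn _ _ gn (pf i))) => t Tt.
by rewrite /partial (deriveM (df t Tt i) (dg t Tt i)).
Qed.

Lemma pdiffV n f : (forall t, Theta t -> f t != 0) ->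
  pdiff n f -> pdiff n (fun t => (f t)^-1).
Proof.
move=> f0; elim: n => //= n IHn [df pf]; split=> [t Tt i | i].
  exact: derivableV (f0 t Tt) (df t Tt i).
have fVn : pdiff n (fun t => (f t)^-1) by apply: IHn; apply: pdiffW; split.
apply: eq_pdiff
  (pdiffM (pdiff_cst n (-1)) (pdiffM (pdiffM fVn fVn) (pf i))) => t Tt.
by rewrite /partial (deriveV (f0 t Tt) (df t Tt i)) mulN1r scaleNr -expr2 exprVn.
Qed.

Lemma pdiff_sum n (I : Type) (r : seq I) (Q : pred I) (F : I -> 'rV[R]_d -> R) :
  (forall i, Q i -> pdiff n (F i)) -> pdiff n (fun t => \sum_(i <- r | Q i) F i t).
Proof.
move=> dF; elim: r => [|a r IHr].
  by apply: eq_pdiff (pdiff_cst n 0) => t _; rewrite big_nil.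
have [Qa|/negPf Qa] := boolP (Q a).
  by apply: eq_pdiff (pdiffD (dF a Qa) IHr) => t _; rewrite big_cons Qa.
by apply: eq_pdiff IHr => t _; rewrite big_cons Qa.
Qed.

Lemma pdiff_prod n (I : Type) (r : seq I) (F : I -> 'rV[R]_d -> R) :
  (forall i, pdiff n (F i)) -> pdiff n (fun t => \prod_(i <- r) F i t).
Proof.
move=> dF; elim: r => [|a r IHr].
  by apply: eq_pdiff (pdiff_cst n 1) => t _; rewrite big_nil.
by apply: eq_pdiff (pdiffM (dF a) IHr) => t _; rewrite big_cons.
Qed.

Lemma pdiff_det n m (A : 'rV[R]_d -> 'M[R]_m) :
  (forall i j, pdiff n (fun t => A t i j)) -> pdiff n (fun t => \det (A t)).
Proof.
move=> dA; apply: pdiff_sum => s _; apply: pdiffM; first exact: pdiff_cst.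
by apply: pdiff_prod => i; exact: dA.
Qed.

Lemma pdiff_adj n m (A : 'rV[R]_d -> 'M[R]_m) :
  (forall i j, pdiff n (fun t => A t i j)) ->
  forall i j, pdiff n (fun t => (\adj (A t)) i j).
Proof.
move=> dA i j; apply: (@eq_pdiff _ (fun t => cofactor (A t) j i)).
  by move=> t _; rewrite mxE.
apply: pdiffM; first exact: pdiff_cst.
apply: pdiff_det => a b; apply: eq_pdiff (dA (lift j a) (lift i b)) => t _.
by rewrite !mxE.
Qed.

Lemma partial_sum (I : finType) (Q : pred I) (F : I -> 'rV[R]_d -> R)
    (i : 'I_d) t :
  (forall a, Q a -> pdiff 1 (F a)) -> Theta t ->
  partial i (fun u => \sum_(a | Q a) F a u) t = \sum_(a | Q a) partial i (F a) t.
Proof.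
(* Filtering the index list first lets the induction assume [Q] of every member, which supplies the
   differentiability that additivity requires. *)
move=> dF Tt; rewrite -big_filter.
transitivity (partial i (fun u => \sum_(a <- [seq a <- index_enum I | Q a]) F a u) t).
  by apply: eq_partial => // u _; rewrite big_filter.
have : all Q [seq a <- index_enum I | Q a] by exact: filter_all.
elim: [seq _ <- _ | _] => [_|a r IHr /= /andP[Qa Qr]].
  rewrite big_nil (_ : (fun _ => _) = cst 0) ?/partial ?derive_cst //.
  by apply/funext => u; rewrite big_nil.
rewrite big_cons -IHr // -partialD; last 2 first.
- exact: (dF a Qa).1.
- suff: pdiff 1 (fun u => \sum_(b <- r) F b u) by case=> /(_ t Tt i).
  apply: (@eq_pdiff _ (fun u => \sum_(b <- r | Q b) F b u)).
    by move=> u _; rewrite big_seq_cond [RHS]big_seq; apply: eq_bigl => b;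
      case: (boolP (b \in r)) => //= /(allP Qr) ->.
  exact: pdiff_sum.
by apply: eq_partial => // u _; rewrite big_cons.
Qed.

(* No differentiability is needed: the difference quotients agree. *)
Lemma partial_addr f (c : R) (i : 'I_d) :
  partial i (fun u => f u + c) = partial i f.
Proof.
apply/funext => t; rewrite /partial /derive.
by under eq_fun do rewrite /= opprD addrACA subrr addr0.
Qed.

Lemma pdiff_stationary n (X : finType) (D : {set X * X})
    (P : 'rV[R]_d -> X * X -> R) (x : X) :
  (0 < #|X|)%N -> strongly_connected D ->
  (forall t, Theta t -> Wstoch D (P t)) ->
  (forall e, pdiff n (fun t => P t e)) ->
  pdiff n (fun t => stationary (P t) x).
Proof.
move=> cX cD WP dP.
have dM i j : pdiff n (fun t => stationary_mx (P t) i j).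
  apply: (@eq_pdiff _ (fun t =>
    ((i == j)%:R + 1) + -1 * P t (enum_val i, enum_val j))).
    by move=> t _; rewrite mxE mulN1r addrAC.
  by apply: pdiffD; [exact: pdiff_cst | apply: pdiffM; first exact: pdiff_cst].
apply: (@eq_pdiff _ (fun t => (\det (stationary_mx (P t)))^-1 *
    \sum_i (\adj (stationary_mx (P t))) i (enum_rank x))).
  by move=> t Tt; rewrite (stationary_cramer cX cD (WP t Tt)).
apply: pdiffM; last by apply: pdiff_sum => i _; exact: pdiff_adj.
apply: pdiffV; last exact: pdiff_det.
by move=> t Tt; rewrite -unitfE; exact: (stationary_mx_unit cX cD (WP t Tt)).
Qed.

End IteratedPartials.

(** * Fibre sums along the vertex map *)

Section FibreSums.
Context {R : realType} {X Y : finType}.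
Variables (D : {set X * X}) (E : {set Y * Y}).
Variables (kappa : Y -> X) (Lambda : Y * Y -> R).
Hypotheses (cardX : (0 < #|X|)%N) (cardY : (0 < #|Y|)%N).
Hypotheses (connD : strongly_connected D) (connE : strongly_connected E).
Hypothesis kappaP : compatible_surjection D E kappa.
Hypothesis Lambda1 : fibrewise_probability D kappa Lambda.

Definition kappa2 (e : Y * Y) : X * X := (kappa e.1, kappa e.2).

Lemma kappa2_in (e : Y * Y) : e \in E -> kappa2 e \in D.
Proof. by case: kappaP => _ <- _ eE; apply/imsetP; exists e. Qed.

(** Change of variables behind all four identities: an integrand that factors through [kappa2] sees
    only the pushforward of the weight [h], taken later to be the edge measure or one of its
    derivatives. *)
Lemma sum_fibre (G hbar : X * X -> R) (h : Y * Y -> R) :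
  (forall a, a \in D -> \sum_(e in E | kappa2 e == a) h e = hbar a) ->
  \sum_(e in E) G (kappa2 e) * h e = \sum_(a in D) G a * hbar a.
Proof.
move=> hE; rewrite (partition_big kappa2 (mem D)) => [|e /kappa2_in //].
apply: eq_bigr => a aD; rewrite -hE // mulr_sumr.
by apply: eq_bigr => e /andP[_ /eqP ->].
Qed.

Section Lift.
Variables (barP : X * X -> R) (P : Y * Y -> R).
Hypotheses (WbarP : Wstoch D barP) (WP : Wstoch E P).
Hypothesis PE : forall e, P e = barP (kappa2 e) * Lambda e.

(** Lumpability: the probability of jumping into a fibre depends on [y] only through [kappa y]. Off
    [D] both sides vanish. *)
Lemma sum_fibre_row (y : Y) (x' : X) :
  \sum_(y' | kappa y' == x') P (y, y') = barP (kappa y, x').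
Proof.
transitivity (\sum_(y' | kappa y' == x') barP (kappa y, x') * Lambda (y, y')).
  by apply: eq_bigr => y' /eqP <-; rewrite PE.
rewrite -mulr_sumr; have [aD|aD] := boolP ((kappa y, x') \in D).
  by rewrite (Lambda1 aD).2 mulr1.
by rewrite WbarP.1.2 // mul0r.
Qed.

(** By lumpability the pushed-forward law is invariant under [barP]; uniqueness identifies it. *)
Lemma pushforward_stationary (x : X) :
  \sum_(y | kappa y == x) stationary P y = stationary barP x.
Proof.
have [ge0 sum1 inv] := stationaryP cardY connE WP; symmetry.
apply: (stationary_uniq cardX connD WbarP (mu := fun x =>
  \sum_(y | kappa y == x) stationary P y)); split=> [z||x'].
- by apply: sumr_ge0.
- by rewrite -sum1 [RHS](partition_big kappa xpredT).
transitivity (\sum_y stationary P y * barP (kappa y, x')).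
  rewrite [RHS](partition_big kappa xpredT) //=.
  apply: eq_bigr => z _; rewrite mulr_suml.
  by apply: eq_bigr => y /eqP ->.
under eq_bigr do rewrite -sum_fibre_row mulr_sumr.
by rewrite exchange_big; apply: eq_bigr => y' _; exact: inv.
Qed.

Lemma sum_fibre_edge (a : X * X) :
  \sum_(e in E | kappa2 e == a) edge_measure P e = edge_measure barP a.
Proof.
case: a => x x'; rewrite /edge_measure -pushforward_stationary mulr_suml /=.
transitivity (\sum_(y | kappa y == x) \sum_(y' | kappa y' == x')
    stationary P y * P (y, y')); last first.
  by apply: eq_bigr => y /eqP <-; rewrite -mulr_sumr sum_fibre_row.
(* The product of the two fibres may contain pairs outside [E], where [P] vanishes. *)
rewrite pair_big /= [RHS](bigID (mem E)) /= [X in _ = _ + X]big1 ?addr0.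
  by apply: eq_big => [[y y']|[y y'] //]; rewrite andbC.
by move=> [y y'] /andP[_ eE]; rewrite WP.1.2 // mulr0.
Qed.

End Lift.
End FibreSums.

(** * Invariance of the metric, the divergence and both connections *)

Theorem lemma4p1 (R : realType) (X Y : finType)
    (D : {set X * X}) (E : {set Y * Y})
    (cardX : (1 < #|X|)%N) (cardY : (1 < #|Y|)%N)
    (connD : strongly_connected D) (connE : strongly_connected E)
    (d : nat) (Theta : set 'rV[R]_d) (barP : 'rV[R]_d -> X * X -> R)
    (smoothP : smooth_family D Theta barP)
    (Lstar : (X * X -> R) -> (Y * Y -> R))
    (embL : Markov_embedding D E Lstar)
    (theta theta' : 'rV[R]_d) (Htheta : Theta theta) (Htheta' : Theta theta')
    (i j k : 'I_d) :
  let P := fun t : 'rV[R]_d => Lstar (barP t) in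
  [/\ fisher_metric E P i j theta = fisher_metric D barP i j theta,
      divergence E (P theta) (P theta') = divergence D (barP theta) (barP theta'),
      e_connection E P i j k theta = e_connection D barP i j k theta &
      m_connection E P i j k theta = m_connection D barP i j k theta].
Proof.
move=> P; have cX := ltnW cardX; have cY := ltnW cardY.
case: smoothP => oT WbarP sP; case: embL => homL [kappa [Lambda [kP LE L1 defL]]].
have WP t : Theta t -> Wstoch E (P t) by move=> Tt; apply/homL/WbarP.
have PE t : Theta t -> forall e, P t e = barP t (kappa2 kappa e) * Lambda e.
  move=> Tt [y y']; rewrite /P defL; last exact: WbarP.
  (* Since [Lambda] is zero off [E], the product formula holds for every pair. *)
  by case: ifPn => // /LE.2 ->; rewrite mulr0.
have barP_gt0 t e : Theta t -> e \in E -> 0 < barP t (kappa2 kappa e).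
  by move=> Tt eE; apply: (WbarP t Tt).1.1; exact: kappa2_in kP _ eE.
have dP n e : pdiff Theta n (fun t => P t e).
  apply: (@eq_pdiff _ _ _ oT _ (fun t => barP t (kappa2 kappa e) * Lambda e)).
    by move=> t Tt; rewrite PE.
  apply: (pdiffM oT) (pdiff_cst oT _ _); exact: smooth_on_pdiff.
have dQ n e : pdiff Theta n (edge_entry P e).
  apply: (pdiffM oT) (dP n e); exact: (pdiff_stationary oT _ cY connE).
have fibQ a t : Theta t ->
    \sum_(e in E | kappa2 kappa e == a) edge_entry P e t = edge_entry barP a t.
  move=> Tt.
  exact: (sum_fibre_edge cX cY connD connE L1 (WbarP t Tt) (WP t Tt) (PE t Tt)).
have fib_dQ a t l : Theta t ->
    \sum_(e in E | kappa2 kappa e == a) partial l (edge_entry P e) t =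
    partial l (edge_entry barP a) t.
  move=> Tt; rewrite -(partial_sum oT) //.
  by apply: (eq_partial oT) => // u Tu; exact: fibQ.
have fib_ddQ a :
    \sum_(e in E | kappa2 kappa e == a) partial i (partial j (edge_entry P e)) theta =
    partial i (partial j (edge_entry barP a)) theta.
  (* Order two for the edge measure is order one for its partial derivatives; [fib_dQ] holds on all
     of [Theta], so it can be differentiated once more. *)
  rewrite -(partial_sum oT) //; last by move=> e _; exact: (dQ 2 e).2.
  by apply: (eq_partial oT) => // u Tu; exact: fib_dQ.
have dlog e t l : e \in E -> Theta t ->
    partial l (log_entry P e) t = partial l (log_entry barP (kappa2 kappa e)) t.
  (* With the parameter-free term [ln (Lambda e)] inserted, the two functions agree on [Theta]. *)
  move=> eE Tt; rewrite -[in RHS](partial_addr _ (ln (Lambda e))).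
  apply: (eq_partial oT) => // u Tu.
  by rewrite /log_entry PE // lnM ?posrE ?LE.1 ?barP_gt0 //.
have ddlog e : e \in E -> partial i (partial j (log_entry P e)) theta =
    partial i (partial j (log_entry barP (kappa2 kappa e))) theta.
  by move=> eE; apply: (eq_partial oT) => // u Tu; exact: dlog.
split.
- rewrite /fisher_metric.
  under eq_bigr => e eE do rewrite !dlog // -mulrA mulrC.
  under [RHS]eq_bigr do rewrite -mulrA mulrC.
  apply: (sum_fibre kP (fun a => partial i (log_entry barP a) theta *
    partial j (log_entry barP a) theta)).
  by move=> a _; exact: fibQ.
- transitivity (\sum_(e in E) ln (barP theta (kappa2 kappa e) /
      barP theta' (kappa2 kappa e)) * edge_entry P e theta).
    apply: eq_bigr => e eE; rewrite mulrC; congr (ln _ * _).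
    (* The factor [Lambda e] is common to both transition probabilities and cancels in the ratio. *)
    have L0 : Lambda e != 0 by rewrite gt_eqF // LE.1.
    by rewrite !PE // invfM mulrACA mulfV // mulr1.
  under [RHS]eq_bigr do rewrite mulrC.
  apply: (sum_fibre kP (fun a => ln (barP theta a / barP theta' a))).
  by move=> a _; exact: fibQ.
- rewrite /e_connection; under eq_bigr => e eE do rewrite ddlog //.
  apply: (sum_fibre kP (fun a => partial i (partial j (log_entry barP a)) theta)).
  by move=> a _; exact: fib_dQ.
(* The weight is now the second derivative of the edge measure, and the integrand a first
   logarithmic derivative. *)
rewrite /m_connection; under eq_bigr => e eE do rewrite dlog // mulrC.
under [RHS]eq_bigr do rewrite mulrC.
apply: (sum_fibre kP (fun a => partial k (log_entry barP a) theta)).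
by move=> a _; exact: fib_ddQ.
Qed.
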